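(* For every integer $k\ge 2$, all integers $m_1,\dots,m_k$ (of any sign) and every integer $n\ge 0$, $$\mathcal D_k(m_1,m_2,\dots,m_k;n)=\sum_{j=0}^{\infty}\binom{j+k-2}{k-2}\,N\Big(\sum_{i=1}^k|m_i|+2j+k-1;\,n\Big).$$
   Context: A partition is a finite nonincreasing sequence $\lambda=(\lambda_1,\dots,\lambda_r)$ of positive integers (the empty partition, $r=0$, is allowed); $l(\lambda)=r$ is its number of parts, $|\lambda|=\sum_i\lambda_i$, and $\lambda_1$ is its largest part. For integers $m$ and $n\ge0$, $N(m;n)$ denotes the number of partitions $\lambda$ of $n$ with rank $\lambda_1-l(\lambda)=m$ (the empty partition of $0$ having rank $0$). Let $k\ge1$. A $k$-marked Durfee symbol of $n$ is an array $\eta=\begin{pmatrix}\alpha^k,&\dots,&\alpha^1\\ \beta^k,&\dots,&\beta^1\end{pmatrix}_D$ consisting of an integer $D\ge0$ and $2k$ partitions $\alpha^i,\beta^i$ with $\sum_{i=1}^k(|\alpha^i|+|\beta^i|)+D^2=n$, such that: (1) $\alpha^i$ is nonempty for $1\le i<k$ ($\alpha^k$ and all $\beta^i$ may be empty); (2) for $1\le i<k$ every part of $\beta^i$ is $\le\alpha^i_1$, and for $2\le i\le k$ every part of $\alpha^i$ and every part of $\beta^i$ is $\ge\alpha^{i-1}_1$; (3) all parts of $\alpha^k$ and $\beta^k$ are $\le D$. The pair $(\alpha^i,\beta^i)$ is the $i$th vector of $\eta$. The $i$th rank is $\rho_i(\eta)=l(\alpha^i)-l(\beta^i)-1$ for $1\le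 i<k$ and $\rho_k(\eta)=l(\alpha^k)-l(\beta^k)$. $\mathcal D_k(m_1,\dots,m_k;n)$ denotes the number of $k$-marked Durfee symbols of $n$ with $\rho_i(\eta)=m_i$ for all $i$.
   Formalization: The definition of a k-marked Durfee symbol additionally requires all parts of every α^i and β^i (not only α^k, β^k) to be at most D; without this the identity fails, e.g. k=2, n=3, m=(0,0), D=0, α^1=(3), other partitions empty. *)

(* Defs.v *)
From mathcomp Require Import all_boot all_order all_algebra.
Set Implicit Arguments. Unset Strict Implicit. Unset Printing Implicit Defensive.
Import GRing.Theory Num.Theory.

Definition is_part (s : seq nat) : bool := sorted geq s && all (fun x => 0 < x) s.

Definition largest (s : seq nat) : nat := head 0 s.

Fixpoint seqs_upto (L B : nat) : seq (seq nat) :=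
  match L with
  | 0 => [:: [::]]
  | L'.+1 => [::] :: [seq x :: s | x <- iota 0 B.+1, s <- seqs_upto L' B]
  end.

(* all partitions of size <= n, without duplicates (a partition of size <= n
   has at most n parts, each <= n, so it appears in seqs_upto n n) *)
Definition partitions_upto (n : nat) : seq (seq nat) :=
  undup [seq s <- seqs_upto n n | is_part s && (sumn s <= n)].

Definition prank (s : seq nat) : int := (Posz (largest s) - Posz (size s))%R.

Definition Nrank (m : int) (n : nat) : nat :=
  size [seq s <- partitions_upto n | (sumn s == n) && (prank s == m)].

Fixpoint tuples (T : Type) (A : seq T) (k : nat) : seq (seq T) :=
  match k with
  | 0 => [:: [::]]
  | k'.+1 => [seq a :: t | a <- A, t <- tuples A k']
  end.

(* A k-marked Durfee symbol is represented as (D, v) where v is the list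
   [:: (alpha^1, beta^1); ...; (alpha^k, beta^k)], i.e. the i-th vector
   (1-based) is at position i-1 of v. *)
Definition dsym := (nat * seq (seq nat * seq nat))%type.

Definition alph (v : seq (seq nat * seq nat)) (i : nat) : seq nat :=
  (nth ([::], [::]) v i).1.
Definition bet (v : seq (seq nat * seq nat)) (i : nat) : seq nat :=
  (nth ([::], [::]) v i).2.

Definition is_durfee (k n : nat) (eta : dsym) : bool :=
  let D := eta.1 in let v := eta.2 in
  [&& size v == k,
      all (fun p => is_part p.1 && is_part p.2) v,
      sumn [seq sumn p.1 + sumn p.2 | p <- v] + D ^ 2 == n,
      all (fun i => alph v i != [::]) (iota 0 k.-1),
      all (fun i => all (fun x => x <= largest (alph v i)) (bet v i)) (iota 0 k.-1),
      all (fun i => all (fun x => largest (alph v i) <= x)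
                        (alph v i.+1 ++ bet v i.+1)) (iota 0 k.-1),
      all (fun x => x <= D) (alph v k.-1 ++ bet v k.-1) &
      (* implicit in Andrews' definition:
         every part of every alpha^i, beta^i is <= D *)
      all (fun p => all (fun x => x <= D) (p.1 ++ p.2)) v].

Definition dranks (k : nat) (v : seq (seq nat * seq nat)) : seq int :=
  [seq (if i < k.-1 then (Posz (size (alph v i)) - Posz (size (bet v i)) - 1)%R
        else (Posz (size (alph v i)) - Posz (size (bet v i)))%R) | i <- iota 0 k].

Definition dsym_cands (k n : nat) : seq dsym :=
  undup [seq (D, v) | D <- iota 0 n.+1,
           v <- tuples [seq (a, b) | a <- partitions_upto n, b <- partitions_upto n] k].

Definition Dcount (k : nat) (ms : seq int) (n : nat) : nat :=
  size [seq eta <- dsym_cands k n | is_durfee k n eta && (dranks k eta.2 == ms)].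

(* Main.v *)
(** Fix the side D of the Durfee square and let T_D(m_k, ..., m_1; s) count the
    symbols whose vectors have all parts at most D, ranks m_k, ..., m_1 and total
    size s.  Looking at whether alpha^k or beta^k contains a part D, and otherwise
    whether alpha^{k-1} starts with D, gives
      T_D(m, ms; s) - T_D(m-1, ms; s-D) - T_D(m+1, ms; s-D) + T_D(m, ms; s-2D)
        = T_{D-1}(m, ms; s) + [m = 0] T_D(ms; s-D),
    and this determines T_D.  By Pascal's rule the sums
      sum_j 'C(j+k-2, j) T_D(|m_1| + ... + |m_k| + 2j + k-1; s)
    obey the same recurrence, so the two agree for each D.  Summing over D with
    s = n - D^2 finishes the proof, since a partition of n with Durfee square of
    side D is a one-vector symbol of the same rank. *)

Require Import Defs.
From mathcomp Require Import all_boot all_order all_algebra.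
From mathcomp Require Import zify.
Set Implicit Arguments. Unset Strict Implicit. Unset Printing Implicit Defensive.
Import GRing.Theory Num.Theory.

(** * Chains: marked symbols over a fixed Durfee side *)

Notation vec := (seq nat * seq nat)%type.

Definition weight (p : vec) : nat := sumn p.1 + sumn p.2.

Definition rank_diff (p : vec) : int := (Posz (size p.1) - Posz (size p.2))%R.

(* The symbol is listed from its last vector [p] down to the first one. The
   leading part [M] of each marked [alpha^i] is stripped before recursing, which
   is what the [- 1] in the ranks below accounts for. *)
Fixpoint chain (D : nat) (p : vec) (w : seq vec) : bool :=
  [&& is_part p.1, is_part p.2, all (geq D) (p.1 ++ p.2) &
   if w is q :: w' then
     if q.1 is M :: a then
       [&& 0 < M, M <= D, all (leq M) (p.1 ++ p.2) & chain M (a, q.2) w']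
     else false
   else true].

(* [s] is an integer, so that the counts vanish for [s < 0] and the recurrence
   below holds with no side condition. *)
Definition chain_with (D : nat) (m : int) (ms : seq int) (s : int)
    (x : vec * seq vec) : bool :=
  [&& chain D x.1 x.2, rank_diff x.1 == m,
      [seq (rank_diff q - 1)%R | q <- x.2] == ms &
      Posz (weight x.1 + sumn (map weight x.2)) == s].

Definition part_pairs (n : nat) : seq vec :=
  [seq (a, b) | a <- partitions_upto n, b <- partitions_upto n].

Definition chains (D : nat) (m : int) (ms : seq int) (s : int) :=
  undup [seq x <- [seq (p, w) | p <- part_pairs `|s|,
                                w <- tuples (part_pairs `|s|) (size ms)] |
         chain_with D m ms s x].

Definition nchains D m ms s : nat := size (chains D m ms s).

(** * Membership in the finite enumerations *)

Lemma mem_seqs_upto (L B : nat) (s : seq nat) :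
  size s <= L -> all (fun x => x <= B) s -> s \in seqs_upto L B.
Proof.
elim: L s => [|L IH] [|x s] //; rewrite ltnS => sL /andP[xB sB].
rewrite in_cons; apply/orP; right; apply/allpairsP; exists (x, s) => /=.
by split => //; [rewrite (mem_iota 0 B.+1) ltnS | apply: IH].
Qed.

Lemma size_le_sumn (s : seq nat) : all (fun x => 0 < x) s -> size s <= sumn s.
Proof. by elim: s => //= x s IH /andP[x0 /IH]; lia. Qed.

Lemma all_le_sumn (s : seq nat) : all (fun x => x <= sumn s) s.
Proof.
elim: s => //= x s IH; rewrite leq_addr /=.
by apply: sub_all IH => y /=; lia.
Qed.

Lemma mem_partitions_upto (n : nat) (s : seq nat) :
  (s \in partitions_upto n) = is_part s && (sumn s <= n).
Proof.
rewrite mem_undup mem_filter; apply: andb_idr => /andP[/andP[_ s0] sn].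
apply: mem_seqs_upto; first exact: leq_trans (size_le_sumn s0) sn.
by apply: sub_all (all_le_sumn s) => x /leq_trans; apply.
Qed.

Lemma mem_part_pairs (n : nat) (p : vec) :
  (p \in part_pairs n) =
  [&& is_part p.1, is_part p.2, sumn p.1 <= n & sumn p.2 <= n].
Proof.
apply/allpairsP/idP => [[[a b] [/= aP bP ->]]|/and4P[a1 a2 b1 b2]] /=.
  by move: aP bP; rewrite !mem_partitions_upto => /andP[-> ->] /andP[-> ->].
by exists p; rewrite !mem_partitions_upto a1 a2 b1 b2 -surjective_pairing.
Qed.

Lemma mem_tuples (T : eqType) (A : seq T) (k : nat) (t : seq T) :
  (t \in tuples A k) = (size t == k) && all (mem A) t.
Proof.
elim: k t => [|k IH] [|x t] //=.
  by apply/allpairsP => -[[? ?] []].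
apply/allpairsP/idP => [[[a u] [/= aA]]|/andP[sk /andP[xA tA]]].
  by rewrite IH => /andP[/eqP <- uA] [-> ->]; rewrite eqxx /= aA.
by exists (x, t); rewrite IH -eqSS sk tA.
Qed.

(** A stripped part [M] bounds the rest of its own [alpha], because that rest heads a chain of side
    [M]; putting [M] back therefore keeps the order. *)
Lemma chain_parts D p w :
  chain D p w -> all (fun q => is_part q.1 && is_part q.2) (p :: w).
Proof.
elim: w D p => [|[[|M a] b] w IH] D p //=.
  by case/and4P=> -> ->.
  by rewrite !andbF.
case/and4P=> -> -> _ /and4P[M0 MD _ wP] /=.
have /= := IH _ _ wP; rewrite -andbA => /and3P[/andP[sa a0] -> ->].
rewrite !andbT; apply/andP; split => /=; last by rewrite M0.
rewrite (path_sortedE (rev_trans leq_trans)) sa andbT.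
by case: w wP {IH} => [|q w] /= /and4P[_ _ /=]; rewrite all_cat => /andP[].
Qed.

(** No vector outweighs the total [s], so bounding the candidates by [s] loses no chain. *)
Lemma mem_chains D m ms s x : (x \in chains D m ms s) = chain_with D m ms s x.
Proof.
rewrite mem_undup mem_filter; apply: andb_idr => /and4P[xP _ /eqP <- /eqP <-].
have /= /andP[/andP[p1 p2] wP] := chain_parts xP.
apply/allpairsP; exists x; rewrite mem_tuples size_map eqxx mem_part_pairs p1 p2.
split=> /=; [by rewrite /weight; lia | | by case: (x)].
apply/allP => q qw; rewrite inE /= mem_part_pairs; have := allP wP _ qw.
have : weight q <= sumn (map weight x.2).
  by have /allP := all_le_sumn (map weight x.2); apply; apply: map_f.
move=> qs /andP[-> ->] /=; move: qs; rewrite {1}/weight.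
by move: (weight x.1) (sumn (map _ _)) => *; lia.
Qed.

(** * Counting by bijections, and degenerate cases *)

Lemma bij_size (T1 T2 : eqType) (l1 : seq T1) (l2 : seq T2) f g :
    uniq l1 -> uniq l2 ->
    {in l1, forall x, f x \in l2 /\ g (f x) = x} ->
    {in l2, forall y, g y \in l1 /\ f (g y) = y} ->
  size l1 = size l2.
Proof.
move=> u1 u2 fP gP; rewrite -(size_map f).
apply/perm_size/uniq_perm => //.
  by rewrite map_inj_in_uniq // => x y /fP[_ {2}<-] /fP[_ {2}<-] ->.
move=> y; apply/mapP/idP => [[x /fP[fx _] ->] //|/gP[gy <-]].
by exists (g y) => //; rewrite gy.
Qed.

Lemma size_eq0_notin (T : eqType) (l : seq T) :
  (forall x, x \notin l) -> size l = 0.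
Proof. by case: l => [//|x l] /(_ x); rewrite mem_head. Qed.

Lemma nchains_eq0 D m ms s :
  (forall x, ~~ chain_with D m ms s x) -> nchains D m ms s = 0.
Proof. by move=> no; apply: size_eq0_notin => x; rewrite mem_chains. Qed.

Lemma nchains_lt0 D m ms s : (s < 0)%R -> nchains D m ms s = 0.
Proof.
move=> s_lt0; apply: nchains_eq0 => x; apply/negP => /and4P[_ _ _ /eqP xs]; lia.
Qed.

Lemma nchains0_gt0 m s : (0 < m)%R -> nchains 0 m [::] s = 0.
Proof.
move=> m_gt0; apply: nchains_eq0.
case=> [[[|a al] [|b be]] [|? ?]]; rewrite /chain_with ?andbF //=.
- by rewrite /rank_diff /=; case: eqP => // mE; lia.
- by case: b => [|b]; rewrite /is_part /= ?(andbF, ltn0).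
- by case: a => [|a]; rewrite /is_part /= ?(andbF, ltn0).
- by case: a => [|a]; rewrite /is_part /= ?(andbF, ltn0).
Qed.

Lemma nchains0_cons m m' ms s : nchains 0 m (m' :: ms) s = 0.
Proof.
apply: nchains_eq0.
case=> [p [|[[|a al] be] w]]; rewrite /chain_with //= ?andbF //.
by case: a; rewrite /= ?andbF.
Qed.

(** A lone vector has the same conditions on both rows, so exchanging them negates the rank. *)
Lemma nchains_sym D m s : nchains D (- m)%R [::] s = nchains D m [::] s.
Proof.
pose f (x : vec * seq vec) := ((x.1.2, x.1.1), x.2).
have fK x : f (f x) = x by case: x => [[? ?] ?].
have fP D' m' x : x \in chains D' m' [::] s -> f x \in chains D' (- m')%R [::] s.
  rewrite !mem_chains /chain_with /f /=; case: x => [[a b] [|? ?]] /=;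
    last by rewrite !andbF.
  rewrite /rank_diff /weight /= !all_cat => /and3P[/and3P[-> -> /andP[/andP[-> ->] _]]].
  by move=> /eqP <- /eqP <-; rewrite opprB !addn0 addnC !eqxx.
apply: (@bij_size _ _ _ _ f f); rewrite ?undup_uniq // => x xP; split=> //.
  by have := fP _ _ _ xP; rewrite opprK.
exact: fP.
Qed.

(** * The recurrence in D *)

Lemma chainC D a b w : chain D (a, b) w = chain D (b, a) w.
Proof.
by case: w => [|[[|M c] d] w] /=;
  rewrite !all_cat andbCA (andbC (all (geq D) b)) ?(andbC (all (leq M) b)).
Qed.

Lemma chain_bound D p w : chain D p w -> all (geq D) (p.1 ++ p.2).
Proof. by case: w => [|q w] /= /and4P[]. Qed.

Lemma is_part_cons D a :
  all (geq D.+1) a -> is_part (D.+1 :: a) = is_part a.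
Proof. by move=> aD; rewrite /is_part /= (path_sortedE (rev_trans leq_trans)) aD. Qed.

(** [D.+1] is the largest part allowed and is at least any marked part [M], so it can be prepended
    or removed freely. *)
Lemma chain_consl D a b w : chain D.+1 (D.+1 :: a, b) w = chain D.+1 (a, b) w.
Proof.
case: (boolP (all (geq D.+1) a)) => [aD|/negPf aD].
  case: w => [|[[|M c] d] w] /=; rewrite is_part_cons // leqnn //=.
  by case: (M <= D.+1).
by case: w => [|[[|M c] d] w] /=; rewrite !all_cat aD ?andbF.
Qed.

Lemma chain_consr D a b w : chain D.+1 (a, D.+1 :: b) w = chain D.+1 (a, b) w.
Proof. by rewrite chainC chain_consl chainC. Qed.

Lemma all_leq_head D s : is_part s -> head 0 s != D.+1 ->
  all (geq D.+1) s = all (geq D) s.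
Proof.
case: s => [|x s] //= /andP[/= sx _] xD.
rewrite leq_eqVlt (negPf xD) ltnS /=; case: (leqP x D) => //= xD'.
rewrite (path_sortedE (rev_trans leq_trans)) in sx; case/andP: sx => sx _.
have sD: all (geq D) s.
  by apply: sub_all sx => y /= /leq_trans; apply.
by rewrite sD; apply: sub_all sD => y /= /leqW.
Qed.

Definition top_marked (D : nat) (w : seq vec) : bool :=
  if w is q :: _ then head 0 q.1 == D else false.

Lemma chain_lower D p w : head 0 p.1 != D.+1 -> head 0 p.2 != D.+1 ->
  chain D.+1 p w && ~~ top_marked D.+1 w = chain D p w.
Proof.
move=> p1 p2; case: (boolP (is_part p.1)) => [P1|/negPf P1]; last first.
  by case: w => [|q w] /=; rewrite P1.
case: (boolP (is_part p.2)) => [P2|/negPf P2]; last first.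
  by case: w => [|q w] /=; rewrite P1 P2.
case: w => [|[[|M c] d] w] /=; rewrite P1 P2 !all_cat !(@all_leq_head D) //=.
- by rewrite !andbT.
- by rewrite !andbF.
rewrite (leq_eqVlt M D.+1) ltnS; case: eqP => [->|_]; last by rewrite andbT.
by rewrite !andbF ltnn !andbF.
Qed.

(** The parts of [p] lie between the marked part and the side, both [D.+1] here; as neither row
    starts with [D.+1], both are empty. *)
Lemma chain_top D p a b w : head 0 p.1 != D.+1 -> head 0 p.2 != D.+1 ->
  chain D.+1 p ((D.+1 :: a, b) :: w) = (p == ([::], [::])) && chain D.+1 (a, b) w.
Proof.
case: p => [[|x p1] [|y p2]] //= xD yD; rewrite !leqnn //=.
- by apply/negbTE; lia.
- by apply/negbTE; lia.
- by apply/negbTE; lia.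
Qed.

Lemma chain_withE D m ms s p w :
  chain_with D m ms s (p, w) =
  [&& chain D p w, rank_diff p == m,
      [seq (rank_diff q - 1)%R | q <- w] == ms &
      Posz (weight p + sumn (map weight w)) == s].
Proof. by []. Qed.

Section Recurrence.

Variables (D : nat) (ms : seq int).
Let E := D.+1.

Let noA (x : vec * seq vec) := head 0 x.1.1 != E.
Let noB (x : vec * seq vec) := head 0 x.1.2 != E.

Let sizeA m s :
  size [seq x <- chains E m ms s | ~~ noA x] = nchains E (m - 1) ms (s - E%:Z).
Proof.
apply: (@bij_size _ _ _ _ (fun x => ((behead x.1.1, x.1.2), x.2))
                          (fun x => ((E :: x.1.1, x.1.2), x.2))).
- by rewrite filter_uniq ?undup_uniq.
- exact: undup_uniq.
- case=> [[a b] w]; rewrite mem_filter !mem_chains /noA negbK /= => /andP[].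
  case: a => [|a0 a] //= /eqP ->; rewrite /chain_with chain_consl /rank_diff /weight /=.
  by case/and4P=> -> /eqP <- -> /eqP <- /=; split => //; apply/andP; split; apply/eqP; lia.
- case=> [[a b] w]; rewrite mem_filter !mem_chains /noA negbK /= eqxx.
  rewrite /chain_with chain_consl /rank_diff /weight /= => /and4P[-> /eqP rE -> /eqP wE] /=.
  by split=> //; apply/andP; split; apply/eqP; lia.
Qed.

(** Removing a leading [E] from [beta] raises the rank by 1 and leaves [alpha] alone, so the
    condition [noA] survives on the right. *)
Let sizeB m s :
  size [seq x <- chains E m ms s | noA x & ~~ noB x] =
  size [seq x <- chains E (m + 1) ms (s - E%:Z) | noA x].
Proof.
apply: (@bij_size _ _ _ _ (fun x => ((x.1.1, behead x.1.2), x.2))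
                          (fun x => ((x.1.1, E :: x.1.2), x.2))).
- by rewrite filter_uniq ?undup_uniq.
- by rewrite filter_uniq ?undup_uniq.
- case=> [[a b] w]; rewrite !mem_filter !mem_chains /noA /noB negbK /= -andbA => /and3P[-> ].
  case: b => [|b0 b] //= /eqP ->; rewrite /chain_with chain_consr /rank_diff /weight /=.
  by case/and4P=> -> /eqP <- -> /eqP <- /=; split => //; apply/andP; split; apply/eqP; lia.
- case=> [[a b] w]; rewrite !mem_filter !mem_chains /noA /noB negbK /= eqxx => /andP[->].
  rewrite /chain_with chain_consr /rank_diff /weight /= => /and4P[-> /eqP rE -> /eqP wE] /=.
  by split=> //; apply/andP; split; apply/eqP; lia.
Qed.

(** With no part [E] in the last vector, either the next marked part is not [E] and the side drops
    to [D], or it is [E], which forces the last vector to be empty; then that vector and the mark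
    are removed together. *)
Let size_rest m s :
  size [seq x <- chains E m ms s | noA x & noB x] =
  nchains D m ms s +
  (if ms is m' :: ms' then (m == 0%R) * nchains E m' ms' (s - E%:Z) else 0).
Proof.
rewrite -(count_predC (fun x => ~~ top_marked E x.2) [seq x <- _ | _]) -!size_filter.
congr addn.
  apply/perm_size/uniq_perm; rewrite ?filter_uniq ?undup_uniq // => x.
  rewrite !mem_filter !mem_chains /noA /noB.
  case: (boolP (head 0 x.1.1 == E)) => [x1|x1]; last case: (boolP (head 0 x.1.2 == E)) => [x2|x2].
  - rewrite andbF; apply/esym/negbTE/negP => /and4P[/chain_bound xD _ _ _].
    by case: x x1 xD => [[[|a0 a] b] w] //= /eqP ->; rewrite ltnn.
  - rewrite andbF; apply/esym/negbTE/negP => /and4P[/chain_bound xD _ _ _].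
    case: x x1 x2 xD => [[a [|b0 b]] w] //= _ /eqP ->.
    by rewrite all_cat /= ltnn andbF.
  - by rewrite /chain_with -(chain_lower _ x1 x2) /= andbC -!andbA; do !bool_congr.
case: ms => [|m' ms'].
  apply: size_eq0_notin => -[p [|q w]]; rewrite !mem_filter mem_chains //.
  by rewrite /chain_with !andbF.
case: eqP => [->|m0]; last first.
  apply: size_eq0_notin => -[p [|[[|M a] b] w]]; rewrite !mem_filter mem_chains //.
  rewrite chain_withE [predC _ _]/= negbK; apply/negP.
  case/andP=> [/eqP-> /andP[/andP[p1 p2] /and4P[]]].
  by rewrite (@chain_top _ p _ _ _ p1 p2) => /andP[/eqP-> _] /eqP; rewrite /rank_diff /=; lia.
rewrite mul1n.
apply: (@bij_size _ _ _ _
  (fun x => let q := head ([::], [::]) x.2 in ((behead q.1, q.2), behead x.2))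
  (fun x => (([::], [::]), (E :: x.1.1, x.1.2) :: x.2))).
- by rewrite !filter_uniq ?undup_uniq.
- exact: undup_uniq.
- case=> [p [|[[|M a] b] w]]; rewrite !mem_filter !mem_chains //.
  rewrite chain_withE [predC _ _]/= negbK.
  case/andP=> [/eqP-> /andP[/andP[p1 p2] /and4P[]]].
  rewrite (@chain_top _ p _ _ _ p1 p2) => /andP[/eqP -> xP] _ /eqP[<- <-] /eqP <-.
  rewrite /chain_with xP /rank_diff /weight /= eqxx.
  by split=> //; apply/andP; split; apply/eqP; lia.
- case=> [[a b] w]; rewrite !mem_filter !mem_chains !chain_withE /predC /top_marked eqxx.
  case/and4P=> xP /eqP <- /eqP <- /eqP xs.
  rewrite /noA /noB (@chain_top _ ([::], [::])) // eqxx xP /=.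
  move: xs; rewrite /rank_diff /weight /= => xs.
  by split=> //; rewrite eqseq_cons !eqxx andbT; apply/and3P; split=> //; apply/eqP; lia.
Qed.

Lemma nchains_rec m s :
  nchains E m ms s + nchains E m ms (s - (E%:Z + E%:Z)) =
  nchains E (m - 1) ms (s - E%:Z) + nchains E (m + 1) ms (s - E%:Z) +
  nchains D m ms s +
  (if ms is m' :: ms' then (m == 0%R) * nchains E m' ms' (s - E%:Z) else 0).
Proof.
have splitA m' s' : nchains E m' ms s' =
    nchains E (m' - 1) ms (s' - E%:Z) + size [seq x <- chains E m' ms s' | noA x].
  by rewrite -sizeA !size_filter addnC count_predC.
have splitB : size [seq x <- chains E m ms s | noA x] =
    size [seq x <- chains E m ms s | noA x & ~~ noB x] +
    size [seq x <- chains E m ms s | noA x & noB x].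
  rewrite -(count_predC noB [seq x <- _ | noA x]) -!size_filter -!filter_predI addnC.
  by congr (_ + _); congr size; apply: eq_filter => x /=; rewrite andbC.
(* Splitting the count of rank [m + 1] and size [s - E] as well trades the leftover condition [noA]
   for the term of size [s - (E + E)]. *)
rewrite (splitA m s) (splitA (m + 1)%R) splitB sizeB size_rest addrK.
by rewrite opprD addrA -!addnA; congr (_ + _); rewrite [RHS]addnC -!addnA.
Qed.

End Recurrence.
(** * Solving the recurrence *)

(** The rank is at most the number of parts of [alpha], hence at most the size. This is what makes
    the sum over [j] finite. *)
Lemma nchains_rank_gt D r s : (s < r)%R -> nchains D r [::] s = 0.
Proof.
move=> sr; apply: nchains_eq0 => -[[a b] [|q w]]; rewrite /chain_with ?andbF //.
apply/negP => /and4P[/= /and3P[/andP[_ /size_le_sumn a_le] _ _]].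
by rewrite /rank_diff /weight /= => /eqP rE _ /eqP sE; lia.
Qed.

(* For [k = 0] the truncated [(j + k).-1] leaves only the term [j = 0]. *)
Definition rank_sum (J D k : nat) (S s : int) : nat :=
  \sum_(j < J) 'C((j + k).-1, j) * nchains D (S + (2 * j + k)%:Z)%R [::] s.

(** One-vector counts obey the recurrence without its last term, and the binomial weights do not
    involve [S]. *)
Lemma rank_sum_rec J D k S s (E := D.+1) :
  rank_sum J E k S s + rank_sum J E k S (s - (E%:Z + E%:Z))%R =
  rank_sum J E k (S - 1)%R (s - E%:Z)%R + rank_sum J E k (S + 1)%R (s - E%:Z)%R +
  rank_sum J D k S s.
Proof.
rewrite /rank_sum -!big_split; apply: eq_bigr => j _ /=.
rewrite -!mulnDr; congr (_ * _); rewrite nchains_rec addn0.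
by rewrite (addrAC S (-1)%R) (addrAC S 1%R).
Qed.

(** Pascal's rule splits ['C(j + k, j)]; the share with lower index [j - 1] is reindexed into a
    weight of [g j.+1], and the isolated term is the boundary of that shift. *)
Lemma pascal_sum (g : nat -> nat) (k J : nat) :
  \sum_(j < J.+1) 'C(j + k, j) * g j + 'C(J + k, J) * g J.+1 =
  \sum_(j < J.+1) 'C(j + k, j) * g j.+1 + \sum_(j < J.+1) 'C((j + k).-1, j) * g j.
Proof.
elim: J => [|J IH]; first by rewrite !big_ord1 !bin0 addnC.
rewrite big_ord_recr [in RHS]big_ord_recr /= [X in _ = _ + X]big_ord_recr /=.
have -> : 'C(J.+1 + k, J.+1) = 'C(J + k, J.+1) + 'C(J + k, J) by rewrite addSn binS.
rewrite mulnDl; move: IH.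
by move: (\sum_(j < _) _) (\sum_(j < _) _) (\sum_(j < _) _) => *; lia.
Qed.

(** Meant for rank 0, where both neighbouring ranks have absolute value 1 while [rank_sum_rec]
    involves [S - 1] and [S + 1]: the discrepancy is the sum with one vector fewer. The bound
    [s < J] kills the boundary term. *)
Lemma rank_sum_pascal J D k S s : (0 <= S)%R -> (s < J%:Z)%R ->
  rank_sum J D k.+1 (S - 1)%R s = rank_sum J D k.+1 (S + 1)%R s + rank_sum J D k S s.
Proof.
move=> S0; case: J => [|J] sJ; first by rewrite /rank_sum !big_ord0.
pose g j := nchains D (S + (2 * j + k)%:Z)%R [::] s.
have := pascal_sum g k J; rewrite {2}/g nchains_rank_gt; last by lia.
rewrite muln0 addn0 => E; rewrite /rank_sum.
under eq_bigr => j _.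
  rewrite addnS /= (_ : (S - 1 + _)%R = (S + (2 * j + k)%:Z)%R); last by lia.
  over.
rewrite E; congr (_ + _); apply: eq_bigr => j _.
by rewrite addnS /g; congr (_ * nchains _ _ _ _); lia.
Qed.

Lemma rank_sum0 J D m s : (s < J%:Z)%R ->
  rank_sum J D 0 (absz m) s = nchains D m [::] s.
Proof.
case: J => [|J] sJ; first by rewrite /rank_sum big_ord0 nchains_lt0.
rewrite /rank_sum big_ord_recl big1 => [|j _]; last first.
  by rewrite bin_small // lift0 addn0.
rewrite bin0 mul1n addn0 addr0.
have [->//|->] : Posz (absz m) = m \/ Posz (absz m) = (- m)%R by lia.
exact: nchains_sym.
Qed.

Lemma nchainsE J D m ms s : (s < J%:Z)%R ->
  nchains D m ms s =
  rank_sum J D (size ms) (Posz (absz m + \sum_(x <- ms) absz x)) s.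
Proof.
elim: D m ms s => [|D IHD] m [|m' ms] s sJ; rewrite ?big_nil ?addn0 ?rank_sum0 //.
  rewrite nchains0_cons /rank_sum big1 // => j _.
  by rewrite nchains0_gt0 ?muln0 //= ; lia.
(* Inner induction on a bound for [s]: every other term of side [D.+1] in the recurrence has a
   smaller size. *)
have [t st] : exists t : nat, (s < t%:Z)%R by exists (absz s).+1; lia.
elim: t m m' ms s st sJ => [|t IHt] m m' ms s st sJ.
  by rewrite nchains_lt0 // /rank_sum big1 // => j _; rewrite nchains_lt0 ?muln0.
have IH r rs : nchains D.+1 r rs (s - D.+1%:Z)%R =
    rank_sum J D.+1 (size rs) (Posz (absz r + \sum_(x <- rs) absz x)) (s - D.+1%:Z)%R.
  case: rs => [|r' rs]; first by rewrite big_nil addn0 rank_sum0 //; lia.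
  by apply: IHt; lia.
have := nchains_rec D (m' :: ms) m s.
rewrite (IHt _ _ _ (s - (_ + _))%R) ?IHD ?IH //; try lia.
have := rank_sum_rec J D (size ms).+1 (Posz (absz m + \sum_(x <- m' :: ms) absz x)) s.
rewrite /= big_cons; move: (absz m' + _) => S.
(* For nonzero [m] the neighbours have absolute values |m| - 1 and |m| + 1 in some order, as in
   [rank_sum_rec]; for [m = 0] Pascal's rule accounts for the extra term. *)
case: (ltrgtP m 0%R) => [m_lt0|m_gt0|->] Hrec.
- rewrite (_ : Posz (absz m + S) - 1 = Posz (absz (m + 1)%R + S))%R in Hrec; last by lia.
  rewrite (_ : Posz (absz m + S) + 1 = Posz (absz (m - 1)%R + S))%R in Hrec; last by lia.
  by move: Hrec; do !move: (rank_sum _ _ _ _ _) => ?; lia.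
- rewrite (_ : Posz (absz m + S) - 1 = Posz (absz (m - 1)%R + S))%R in Hrec; last by lia.
  rewrite (_ : Posz (absz m + S) + 1 = Posz (absz (m + 1)%R + S))%R in Hrec; last by lia.
  by move: Hrec; do !move: (rank_sum _ _ _ _ _) => ?; lia.
- rewrite /= add0n in Hrec *.
  rewrite rank_sum_pascal // in Hrec; last by lia.
  rewrite (_ : Posz S + 1 = Posz (1 + S))%R in Hrec; last by lia.
  by move: Hrec; do !move: (rank_sum _ _ _ _ _) => ?; lia.
Qed.

(** * Durfee squares *)

Lemma leq_sqr D : D <= D ^ 2.
Proof. by case: D => // D; rewrite -mulnn leq_pmulr. Qed.

Lemma size_allpairs_iota (T : Type) (l : nat -> seq T) (n : nat) :
  size [seq (D, x) | D <- iota 0 n, x <- l D] = \sum_(D < n) size (l D).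
Proof. by rewrite size_allpairs_dep sumnE big_map -{1}(subn0 n) big_mkord. Qed.

Lemma uniq_allpairs_iota (T : eqType) (l : nat -> seq T) (n : nat) :
  (forall D, uniq (l D)) -> uniq [seq (D, x) | D <- iota 0 n, x <- l D].
Proof.
move=> lu; apply: allpairs_uniq_dep => [|D _|]; rewrite ?iota_uniq //.
by move=> [D x] [D' x'] _ _ /= [-> ->].
Qed.

(** For parts at most [r], this is the conjugate partition padded with zeros to length [r]; the
    padding gives every row of a Durfee square an entry. *)
Definition conj_part (r : nat) (s : seq nat) : seq nat :=
  [seq count (fun x => j < x) s | j <- iota 0 r].

Lemma size_conj_part r s : size (conj_part r s) = r.
Proof. by rewrite size_map size_iota. Qed.

Lemma conj_part_sorted r s : sorted geq (conj_part r s).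
Proof.
apply: (@homo_sorted _ _ _ leq); last exact: iota_sorted.
by move=> i j ij /=; apply: sub_count => x /=; apply: leq_ltn_trans.
Qed.

(** Both inequalities say that the Young diagram of [s] has a cell in row [i] and column [j]. *)
Lemma count_gt_nth s i j :
  sorted geq s -> (i < count (fun x => j < x) s) = (j < nth 0 s i).
Proof.
elim: s i => [|x s IH] i; first by rewrite nth_nil.
move=> /= xs; have /IH {}IH := path_sorted xs.
case: (ltnP j x) => xj; first by case: i => [|i] //=; rewrite add1n ltnS IH.
have s0 : count (fun x => j < x) s = 0.
  apply/eqP; rewrite eqn0Ngt -has_count; apply/hasPn => y ys.
  rewrite (path_sortedE (rev_trans leq_trans)) in xs; case/andP: xs => /allP /(_ y ys) /= yx _.
  by rewrite -leqNgt (leq_trans yx).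
by rewrite s0; case: i => [|i] /=; [lia | rewrite -IH s0].
Qed.

Lemma count_lt_iota c D : c <= D -> count (fun j => j < c) (iota 0 D) = c.
Proof.
move=> cD; rewrite -(subnKC cD) iotaD count_cat.
rewrite (@eq_in_count _ _ predT) => [|j]; last by rewrite mem_iota => /andP[].
rewrite count_predT size_iota (@eq_in_count _ _ pred0) ?count_pred0 ?addn0 // => j.
by rewrite mem_iota => /andP[cj _]; apply/negbTE; rewrite -leqNgt.
Qed.

Lemma conj_partK r s :
  sorted geq s -> all (geq r) s -> conj_part (size s) (conj_part r s) = s.
Proof.
move=> s_sorted sr; apply: (@eq_from_nth _ 0); rewrite size_conj_part // => i si.
rewrite (nth_map 0) ?size_iota // nth_iota // add0n count_map.
rewrite (@eq_count _ _ (fun j => j < nth 0 s i)) => [|j] /=; last by rewrite count_gt_nth.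
by rewrite count_lt_iota //; apply: (allP sr); apply: mem_nth.
Qed.

Lemma sumn_conj_part r s : all (geq r) s -> sumn (conj_part r s) = sumn s.
Proof.
elim: s => [|x s IH] /=; first by rewrite /conj_part /= sumnE big_map big1.
case/andP=> xr /IH <-; rewrite -[x in RHS](count_lt_iota xr) -sumn_count !sumnE.
by rewrite !big_map -big_split.
Qed.

(** A square of side [D], with [a] listing the columns to its right and [b] the rows below it. *)
Definition durfee_glue (D : nat) (a b : seq nat) : seq nat :=
  map (addn D) (conj_part D a) ++ b.

(** With rows counted from 0, the first row [i] of length at most [i] lies just below the Durfee
    square; if there is none, [find] returns the number of rows. *)
Definition durfee_side (s : seq nat) : nat :=
  find (fun i => nth 0 s i <= i) (iota 0 (size s)).

Lemma durfee_glue_part D a b : is_part b -> all (geq D) b -> is_part (durfee_glue D a b).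
Proof.
case/andP=> sb b0 bD; apply/andP; split.
  rewrite (sorted_pairwise (rev_trans leq_trans)) pairwise_cat.
  rewrite -!(sorted_pairwise (rev_trans leq_trans)) sb andbT; apply/andP; split.
    apply/allrelP => x y /mapP[z _ ->] /(allP bD) /= yD.
    exact: leq_trans yD (leq_addr _ _).
  apply: homo_sorted (conj_part_sorted D a) => x y /=.
  by rewrite leq_add2l.
rewrite all_cat b0 andbT all_map; case: D {bD} => [//|D].
by apply/allP => x.
Qed.

Lemma sumn_durfee_glue D a b :
  all (geq D) a -> sumn (durfee_glue D a b) = D ^ 2 + sumn a + sumn b.
Proof.
move=> aD; rewrite sumn_cat; congr (_ + _).
have sumn_add l : sumn (map (addn D) l) = size l * D + sumn l.
  by elim: l => //= x l ->; lia.
by rewrite sumn_add size_conj_part mulnn sumn_conj_part.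
Qed.

(** For positive [D] the largest part is [D + size a], since all columns in [a] meet the top row,
    and there are [D + size b] parts. For [D = 0] everything is empty. *)
Lemma prank_durfee_glue D a b : is_part a -> all (geq D) (a ++ b) -> is_part b ->
  prank (durfee_glue D a b) = rank_diff (a, b).
Proof.
case/andP=> _ a0; rewrite all_cat => /andP[aD bD] /andP[_ b0].
rewrite /prank /rank_diff /= size_cat size_map size_conj_part.
case: D aD bD => [|D] aD bD /=.
  by case: a a0 aD => [|[|x] a]; case: b b0 bD => [|[|y] b].
by move: a0; rewrite all_count => /eqP ->; lia.
Qed.

Lemma durfee_side_glue D a b : all (geq D) b -> durfee_side (durfee_glue D a b) = D.
Proof.
move=> bD; rewrite /durfee_side size_cat size_map size_conj_part iotaD find_cat.
case: hasP => [[i]|_].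
  rewrite mem_iota add0n => /andP[_ iD].
  rewrite nth_cat size_map size_conj_part iD (nth_map 0) ?size_conj_part //; lia.
rewrite size_iota -[RHS]addn0; congr (_ + _); case: b bD => [|x b] //= /andP[xD _].
by rewrite nth_cat size_map size_conj_part ltnn subnn /= xD.
Qed.

Lemma durfee_side_le s : durfee_side s <= size s.
Proof. by rewrite -[X in _ <= X](size_iota 0) find_size. Qed.

Lemma durfee_side_take s : sorted geq s -> all (leq (durfee_side s)) (take (durfee_side s) s).
Proof.
move=> s_sorted; have Ds := durfee_side_le s; apply/(all_nthP 0) => i.
rewrite size_takel // => iD; rewrite nth_take //.
have D0 : 0 < durfee_side s by lia.
have /(before_find 0) : (durfee_side s).-1 < durfee_side s by lia.
rewrite nth_iota ?add0n; last by lia.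
have := @sorted_leq_nth _ geq (rev_trans leq_trans) leqnn 0 _ s_sorted i (durfee_side s).-1.
by rewrite !inE => /(_ _ _ _) /=; lia.
Qed.

Lemma durfee_side_drop s : sorted geq s -> all (geq (durfee_side s)) (drop (durfee_side s) s).
Proof.
move=> s_sorted; apply/(all_nthP 0) => i; rewrite size_drop nth_drop => iD.
have hasD : has (fun i => nth 0 s i <= i) (iota 0 (size s)).
  by rewrite has_find size_iota -/(durfee_side s); lia.
have := nth_find 0 hasD; rewrite -/(durfee_side s) nth_iota ?add0n; last by lia.
have := @sorted_leq_nth _ geq (rev_trans leq_trans) leqnn 0 _ s_sorted (durfee_side s) (durfee_side s + i).
by rewrite !inE => /(_ _ _ _) /=; lia.
Qed.

Lemma Nrank_durfee (m : int) (n : nat) :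
  Nrank m n = \sum_(D < n.+1) nchains D m [::] (n%:Z - (D ^ 2)%:Z)%R.
Proof.
rewrite -(@size_allpairs_iota _ (fun D => chains D m [::] (n%:Z - (D ^ 2)%:Z)%R)).
(* The rows to the right of the square, some possibly 0. The head of this list is the number of
   columns there, so conjugating to that length produces no zero part. *)
pose ungap s := map (subn^~ (durfee_side s)) (take (durfee_side s) s).
apply/esym/(@bij_size _ _ _ _ (fun x => durfee_glue x.1 x.2.1.1 x.2.1.2)
  (fun s => (durfee_side s,
     ((conj_part (head 0 (ungap s)) (ungap s), drop (durfee_side s) s), [::])))).
- by apply: uniq_allpairs_iota => D; rewrite undup_uniq.
- by rewrite filter_uniq ?undup_uniq.
- move=> x /allpairsPdep[D [[[a b] [|q w]] [_]]]; rewrite mem_chains /chain_with ?andbF //.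
  case/and4P=> /= /and4P[a_part b_part abD _] /eqP rE _ /eqP sE ->.
  have := abD; rewrite all_cat => /andP[aD bD].
  have sn : sumn (durfee_glue D a b) = n.
    by rewrite sumn_durfee_glue //; move: sE; rewrite /weight /=; lia.
  split; first by rewrite mem_filter mem_partitions_upto /= sn eqxx leqnn
                   durfee_glue_part // prank_durfee_glue // rE eqxx.
  rewrite /= /ungap durfee_side_glue //.
  rewrite take_size_cat ?drop_size_cat ?size_map ?size_iota //.
  rewrite -map_comp (@eq_map _ _ _ id) ?map_id => [|i /=]; last by rewrite addKn.
  do 3! congr (_, _).
  have -> : head 0 (conj_part D a) = size a; last by case/andP: a_part => *; exact: conj_partK.
  case: D aD {abD bD sE sn} => [|D] aD.
    by case/andP: a_part => _; case: a aD {rE} => [|[|z] a].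
  by case/andP: a_part => _; rewrite all_count => /eqP.
- move=> s; rewrite mem_filter mem_partitions_upto.
  case/andP=> /andP[/eqP sn /eqP sr] /andP[s_part _].
  have [s_sorted s0] := andP s_part.
  set D := durfee_side s; set u := ungap s; set r := head 0 u.
  have su : size u = D by rewrite size_map size_takel ?durfee_side_le.
  have u_sorted : sorted geq u.
    apply: homo_sorted (take_sorted _ s_sorted) => x y /=; exact: leq_sub2r.
  have ur : all (geq r) u.
    by move: u_sorted; rewrite /r; case: (u) => //= x l /order_path_min -> ; rewrite ?leqnn //; exact: rev_trans leq_trans.
  have rD : all (geq D) (conj_part r u).
    by rewrite all_map -su; apply/allP => j _ /=; apply: count_size.
  have r_part : is_part (conj_part r u).
    rewrite /is_part conj_part_sorted; apply/allP => _ /mapP[j + ->].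
    rewrite mem_iota add0n /r -has_count => /andP[_]; case: (u) => //= x l ->.
    by [].
  have d_part : is_part (drop D s).
    rewrite /is_part drop_sorted //; apply/allP => x /mem_drop; exact: (allP s0).
  have dD : all (geq D) (drop D s) by exact: durfee_side_drop.
  have glueK : durfee_glue D (conj_part r u) (drop D s) = s.
    have uK : conj_part D (conj_part r u) = u by rewrite -{1}su conj_partK.
    rewrite /durfee_glue uK -[RHS](cat_take_drop D); congr (_ ++ _).
    rewrite -map_comp map_id_in // => x xs /=; apply: subnKC.
    exact: (allP (durfee_side_take s_sorted)).
  split=> //; have := sumn_durfee_glue (drop D s) rD; rewrite glueK sn => nE.
  apply/allpairsPdep; exists D, (conj_part r u, drop D s, [::]).
  have rdD : all (geq D) (conj_part r u ++ drop D s) by rewrite all_cat rD.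
  have := prank_durfee_glue r_part rdD d_part; rewrite glueK sr => rE.
  rewrite mem_iota mem_chains /chain_with /= r_part d_part rdD -rE eqxx; split=> //.
    by have := leq_sqr D; lia.
  rewrite /weight /=; apply/eqP.
  by move: nE; move: (D ^ 2) (sumn _) (sumn _) => *; lia.
Qed.

(** * Marked symbols as chains *)

(** Conditions (1) and (2) of a marked symbol for an [i]th vector [q] and its successor [q']. Chains
    run downwards, so their paths use this relation with its arguments swapped. *)
Definition linked (q q' : vec) : bool :=
  [&& q.1 != [::], all (geq (largest q.1)) q.2 &
      all (leq (largest q.1)) (q'.1 ++ q'.2)].

Lemma part_le_head a : is_part a -> all (geq (head 0 a)) a.
Proof.
case: a => [|x a] //= /andP[/(order_path_min (rev_trans leq_trans)) /= -> _].
by rewrite leqnn.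
Qed.

(** Each marked part bounds all vectors after it in the list and is itself at most the current side,
    so the nested bounds imply the global bound [D]. *)
Lemma chain_linked D p w : chain D p w ->
  path (fun q' q => linked q q') p w && all (fun q => all (geq D) (q.1 ++ q.2)) w.
Proof.
elim: w D p => [|[[|M a] b] w IH] D p //=; first by rewrite !andbF.
case/and4P=> _ _ pD /and4P[M0 MD pM wP].
have := chain_bound wP; rewrite /= all_cat => /andP[aM bM].
have /andP[w_path wM] := IH _ _ wP.
rewrite /linked /= bM pM MD /= all_cat.
have leD : subpred (geq M) (geq D) by move=> x /= /leq_trans; apply.
rewrite (sub_all leD aM) (sub_all leD bM) andbT; apply/andP; split.
  case: w w_path wM {wP IH} => [|q w] //= /andP[/and3P[-> -> /= ->] ->].
  by case: (q) => [[|x l] d] //= /andP[/andP[-> _] _].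
by apply: sub_all wM => q; apply: sub_all.
Qed.

(** Once [M] is stripped it becomes the new side: it bounds the rest of its own vector by order and
    by [linked], and the next link bounds the next marked part by [M]. *)
Lemma linked_chain D p w :
    all (fun q => is_part q.1 && is_part q.2) (p :: w) ->
    all (geq D) (p.1 ++ p.2) -> (if w is q :: _ then largest q.1 <= D else true) ->
    path (fun q' q => linked q q') p w ->
  chain D p w.
Proof.
elim: w D p => [|[[|M a] b] w IH] D p /=.
- by rewrite andbT => /andP[-> ->] ->.
- by rewrite andbF.
case/andP=> /andP[-> ->] /andP[/andP[Ma_part b_part] w_part] -> MD.
case/andP=> /and3P[_ /= bM pM] w_path; rewrite MD pM /=.
have /= /andP[_ aM] := part_le_head Ma_part.
have [Ma_sorted /= /andP[M0 a0]] := andP Ma_part.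
rewrite M0; apply: IH.
- by rewrite /= b_part w_part /is_part a0 (path_sorted Ma_sorted).
- by rewrite all_cat aM bM.
- by case: w w_path {w_part} => [//|q w] /= /andP[/and3P[_ _ /andP[]]].
- by case: w w_path {w_part} => [//|q w]; rewrite /linked /= => /andP[/and3P[-> -> /andP[_ ->]] ->].
Qed.

Lemma chain_linkedE D p w :
  chain D p w =
  [&& all (fun q => is_part q.1 && is_part q.2) (p :: w),
      all (fun q => all (geq D) (q.1 ++ q.2)) (p :: w) &
      path (fun q' q => linked q q') p w].
Proof.
apply/idP/idP => [pw|/and3P[pw_part /= /andP[pD wD] pw_path]].
  have /andP[pw_path wD] := chain_linked pw.
  by rewrite (chain_parts pw) pw_path /= wD (chain_bound pw).
apply: linked_chain => //; case: w wD {pw_part pw_path} => [//|[[|x l] b] w] //=.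
by case/andP=> /andP[].
Qed.

Lemma is_durfee_rev k n D p w : size w = k ->
  is_durfee k.+1 n (D, rev (p :: w)) =
  chain D p w && (Posz (weight p + sumn (map weight w)) == n%:Z - (D ^ 2)%:Z)%R.
Proof.
move=> wk; set v := rev (p :: w).
have vk : size v = k.+1 by rewrite size_rev /= wk.
have last_v : nth ([::], [::]) v k = p by rewrite /v rev_cons nth_rcons size_rev wk ltnn eqxx.
have wt_v : sumn [seq sumn p.1 + sumn p.2 | p <- v] = weight p + sumn (map weight w).
  by rewrite /v map_rev sumn_rev.
have linkedE : path (fun q' q => linked q q') p w =
    [&& all (fun i => alph v i != [::]) (iota 0 k),
        all (fun i => all (fun x => x <= largest (alph v i)) (bet v i)) (iota 0 k) &
        all (fun i => all (fun x => largest (alph v i) <= x)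
                          (alph v i.+1 ++ bet v i.+1)) (iota 0 k)].
  (* Read index by index, the three families of conditions are sortedness for [linked]; reversal
     makes it a path down from the last vector. *)
  transitivity (sorted linked v); first by rewrite rev_sorted.
  rewrite -!all_predI; apply/(sortedP ([::], [::]))/allP => [vP i|vP i iv].
    by rewrite mem_iota add0n => ik; apply: vP; rewrite vk.
  by apply: vP; rewrite mem_iota add0n; rewrite vk in iv.
have sumE : (Posz (weight p + sumn (map weight w)) == n%:Z - (D ^ 2)%:Z)%R =
    (weight p + sumn (map weight w) + D ^ 2 == n).
  by apply/eqP/eqP; lia.
have allv (P : pred vec) : all P (p :: w) = all P v by rewrite all_rev.
have [alpha_k beta_k] : alph v k = p.1 /\ bet v k = p.2 by rewrite /alph /bet last_v.
have pD : all (fun q => all (geq D) (q.1 ++ q.2)) v -> all (geq D) (p.1 ++ p.2).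
  by rewrite -allv => /andP[].
rewrite /is_durfee [_.1]/= [_.2]/= [_.+1.-1]/= vk eqxx wt_v -sumE chain_linkedE linkedE.
rewrite alpha_k beta_k !allv (andb_idl pD) -!andbA /=.
by do !bool_congr.
Qed.

Lemma dranks_rev k p w : size w = k ->
  dranks k.+1 (rev (p :: w)) =
  rev (rank_diff p :: [seq (rank_diff q - 1)%R | q <- w]).
Proof.
move=> wk; rewrite /dranks -[in iota _ _]addn1 iotaD map_cat [RHS]rev_cons -cats1; congr (_ ++ _).
  rewrite -map_rev; apply: (@eq_from_nth _ 0%R); rewrite !size_map size_iota ?size_rev // => i ik.
  rewrite (nth_map 0) ?size_iota // (nth_map ([::], [::])) ?size_rev ?wk //.
  rewrite nth_iota // add0n ik /alph /bet rev_cons nth_rcons size_rev wk ik.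
  by [].
by rewrite add0n /= ltnn /alph /bet rev_cons nth_rcons size_rev wk ltnn eqxx.
Qed.

Lemma mem_dsym_cands k n eta : is_durfee k n eta -> eta \in dsym_cands k n.
Proof.
case: eta => D v /and4P[/= vk v_part /eqP v_sum _].
rewrite mem_undup; apply/allpairsP; exists (D, v); split=> //=.
  by rewrite (mem_iota 0 n.+1) add0n ltnS; have := leq_sqr D; lia.
rewrite mem_tuples vk; apply/allP => q qv /=; rewrite mem_part_pairs.
have : weight q <= sumn (map weight v).
  by have /allP := all_le_sumn (map weight v); apply; apply: map_f.
have /andP[-> ->] := allP v_part _ qv; rewrite -v_sum /= /weight => q_le.
by apply/andP; split; apply: leq_trans (leq_addr _ _); apply: leq_trans q_le; lia.
Qed.

Lemma Dcount_chains n m ms :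
  Dcount (size ms).+1 (rev (m :: ms)) n =
  \sum_(D < n.+1) nchains D m ms (n%:Z - (D ^ 2)%:Z)%R.
Proof.
set k := size ms.
have chain_withE' D p w : chain_with D m ms (n%:Z - (D ^ 2)%:Z)%R (p, w) =
    is_durfee k.+1 n (D, rev (p :: w)) && (dranks k.+1 (rev (p :: w)) == rev (m :: ms)).
  (* For a wrong length both sides are false: one through the list of ranks, the other through the
     number of vectors. *)
  have [wk|wk] := eqVneq (size w) k; last first.
    rewrite /is_durfee /= size_rev /= eqSS (negPf wk) chain_withE.
    apply/negbTE/negP => /and4P[_ _ /eqP msE _].
    by rewrite /k -msE size_map eqxx in wk.
  rewrite is_durfee_rev // dranks_rev // (inj_eq (can_inj revK)) eqseq_cons chain_withE.
  by rewrite -!andbA; do !bool_congr.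
rewrite -(@size_allpairs_iota _ (fun D => chains D m ms (n%:Z - (D ^ 2)%:Z)%R)).
apply: (@bij_size _ _ _ _
  (fun eta => (eta.1, (head ([::], [::]) (rev eta.2), behead (rev eta.2))))
  (fun x => (x.1, rev (x.2.1 :: x.2.2)))).
- by rewrite filter_uniq ?undup_uniq.
- by apply: uniq_allpairs_iota => D; rewrite undup_uniq.
- case=> D v; rewrite mem_filter => /andP[/andP[vP vr] _].
  move: vP vr; rewrite -(revK v); case: (rev v) => [|p w] vP vr.
    by case/andP: vP.
  split; last by rewrite /= revK.
  apply/allpairsPdep; exists D, (p, w).
  split; [| by rewrite mem_chains chain_withE' vP | by rewrite /= revK].
  case/and4P: vP => _ _ /= /eqP vP _; rewrite (mem_iota 0 n.+1) add0n ltnS.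
  by have := leq_sqr D; lia.
- move=> x /allpairsPdep[D [[p w] [_ + ->]]]; rewrite mem_chains chain_withE'.
  case/andP=> vP vr; rewrite /= revK; split=> //.
  by rewrite mem_filter mem_dsym_cands // andbT; apply/andP.
Qed.

(* The infinite series of naturals equals D iff its partial sums are
   eventually equal to D. *)
Theorem mainTheorem1 (k n : nat) (ms : seq int) :
  2 <= k -> size ms = k ->
  exists J0 : nat, forall J : nat, J0 <= J ->
    Dcount k ms n =
    \sum_(j < J) 'C(j + k - 2, k - 2) *
        Nrank (Posz (\sum_(m <- ms) absz m + 2 * j + k - 1)) n.
Proof.
(* The cutoff [n.+1] works because each size [n - D ^ 2] is at most [n], hence below [J]. *)
move=> k2 msk; exists n.+1 => J nJ.
move: (revK ms) msk; case: (rev ms) => [|m l] <-; first by move=> /= ?; lia.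
rewrite size_rev /= => lk; rewrite -lk Dcount_chains.
rewrite (perm_big (m :: l)) /=; last by rewrite perm_rev.
rewrite big_cons.
under eq_bigr => D _.
  rewrite (@nchainsE J); last by lia.
  over.
rewrite /rank_sum exchange_big /=; apply: eq_bigr => j _.
rewrite Nrank_durfee big_distrr /=; apply: eq_bigr => D _.
congr (_ * nchains _ _ _ _); last by lia.
(* The symmetry of binomial coefficients turns the lower index [k - 2] into [j]. *)
rewrite -(@bin_sub (j + (size l).+1 - 2)); last by lia.
by congr 'C(_, _); lia.
Qed.
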